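(* Let $G(I,P;E)$ be a pinned graph satisfying the Pinned Framework Conditions. Identify all pinned vertices to a single vertex $p^*$, obtaining the (multi)graph $G^*=(V,E)$ with $V=I\cup\{p^*\}$. Then the degree of freedom (DOF) of $G^*$ equals one less than the number of rigidity circuits contained in $G^*$.
   Context: A pinned graph $G(I,P;E)$ consists of a finite set $I$ of inner vertices, a finite set $P$ of pinned vertices (disjoint from $I$), and a finite set $E$ of edges, each joining two distinct vertices and having at least one endpoint in $I$. For a nonempty $E'\subseteq E$, let $I'$, $P'$ be the inner and pinned vertices incident to $E'$. $G$ satisfies the Pinned Framework Conditions if $|E|=2|I|$ and for every nonempty $E'\subseteq E$: $|E'|\le 2|I'|$ if $|P'|\ge2$; $|E'|\le 2|I'|-1$ if $|P'|=1$; $|E'|\le 2|I'|-3$ if $P'=\emptyset$. For a (multi)graph $H$ on $n$ vertices placed at points $\mathbf{p}_1,\dots,\mathbf{p}_n\in\mathbb{R}^2$, the rigidity matrix has one row per edge $(i,j)$, with $\mathbf{p}_i-\mathbf{p}_j$ in the two columns of $i$, $\mathbf{p}_j-\mathbf{p}_i$ in the two columns of $j$, zeros elsewhere. For a generic placement, linear (in)dependence of rows defines the generic 2-dimensional rigidity matroid on the edges; its rank $\rho$ depends only on $H$, and the DOF of $H$ is $2n-3-\rho$. A rigidity circuit is a minimally dependent edge set of this matroid; equivalently a nonempty edge set $C$ with $|C|=2|V(C)|-2$ such that every nonempty proper subset $F\subsetneq C$ satisfies $|F|\le 2|V(F)|-3$ (here $V(F)$ is the set of vertices incident to $F$). *)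

(* Defs.v *)
From HB Require Import structures.
From mathcomp Require Import all_boot all_order all_algebra.
From mathcomp Require Import reals.
From mathcomp Require Import mpoly.

Set Implicit Arguments.
Unset Strict Implicit.
Unset Printing Implicit Defensive.

Import Order.TTheory GRing.Theory Num.Theory.

Local Open Scope ring_scope.

(* Edges are indexed by E, so parallel edges are allowed and loops are not.
   Each edge is stored as an ordered pair of endpoints; no notion below depends
   on the order within the pair. *)
Record multigraph (V E : finType) := Multigraph {
  ends : E -> V * V;
  ends_neq : forall e, (ends e).1 != (ends e).2
}.

Definition incident (V E : finType) (H : multigraph V E) (v : V) (e : E) :=
  (v == (ends H e).1) || (v == (ends H e).2).

Definition vertices (V E : finType) (H : multigraph V E) (F : {set E}) :
    {set V} :=
  [set v | [exists e in F, incident H v e]].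

Section Rigidity.
Variables (R : realType) (V E : finType).
Implicit Types (p : V -> 'rV[R]_2) (H : multigraph V E) (F : {set E}).

(* The coordinates of all the points are algebraically independent over the
   rationals: no nonzero rational polynomial, in one variable for each pair of
   a vertex and a coordinate, vanishes at p. *)
Definition generic p : Prop :=
  forall q : {mpoly rat[#|{: V * 'I_2}|]}, q != 0 ->
    meval (fun k => p (enum_val k).1 0 (enum_val k).2)
          (map_mpoly (ratr : rat -> R) q) != 0.

Definition rigidity_entry p H (e : E) (v : V) (c : 'I_2) : R :=
  if v == (ends H e).1 then (p (ends H e).1 - p (ends H e).2) 0 c
  else if v == (ends H e).2 then (p (ends H e).2 - p (ends H e).1) 0 c
  else 0.

Definition rigidity_matrix p H F : 'M[R]_(#|F|, #|{: V * 'I_2}|) :=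
  \matrix_(i, k)
    rigidity_entry p H (enum_val i) (enum_val k).1 (enum_val k).2.

Definition independent p H F : bool := row_free (rigidity_matrix p H F).

Definition rigidity_rank p H : nat := \rank (rigidity_matrix p H [set: E]).

(* Integer-valued: it is -1 for a single vertex without edges. *)
Definition dof p H : int :=
  2 * (#|V|)%:Z - 3 - (rigidity_rank p H)%:Z.

Definition rigidity_circuits p H : {set {set E}} :=
  [set C | minset (fun F => ~~ independent p H F) C].

End Rigidity.

(* A vertex inl i is inner, a vertex inr x is pinned.  Parallel edges are not
   excluded here, but pinned_framework_conditions excludes them. *)
Record pinned_graph (I P E : finType) := PinnedGraph {
  pinned_multigraph :> multigraph (I + P)%type E;
  inner_end : forall e, exists i : I, incident pinned_multigraph (inl i) e
}.

Section Pinned.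
Variables (I P E : finType) (G : pinned_graph I P E).

Definition inner_vertices (F : {set E}) : {set I} :=
  [set i | inl i \in vertices G F].

Definition pinned_vertices (F : {set E}) : {set P} :=
  [set x | inr x \in vertices G F].

Definition pinned_framework_conditions : Prop :=
  #|E| = (2 * #|I|)%N /\
  forall F : {set E}, F != set0 ->
    [/\ (2 <= #|pinned_vertices F|)%N ->
          (#|F|)%:Z <= 2 * (#|inner_vertices F|)%:Z,
        #|pinned_vertices F| = 1%N ->
          (#|F|)%:Z <= 2 * (#|inner_vertices F|)%:Z - 1
      & pinned_vertices F = set0 ->
          (#|F|)%:Z <= 2 * (#|inner_vertices F|)%:Z - 3].

(* None is the vertex to which all the pinned vertices are identified. *)
Definition identify (v : I + P) : option I :=
  match v with inl i => Some i | inr _ => None end.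

Lemma identify_ends_neq (e : E) :
  identify (ends G e).1 != identify (ends G e).2.
Proof.
case: (inner_end G e) => i; rewrite /incident; move: (ends_neq G e).
case: (ends G e) => [[a|x] [b|y]] //=.
Qed.

Definition identify_pins : multigraph (option I) E :=
  @Multigraph (option I) E
    (fun e => (identify (ends G e).1, identify (ends G e).2))
    identify_ends_neq.

End Pinned.

(* Main.v *)
Require Import Defs.
From HB Require Import structures.
From mathcomp Require Import all_boot all_order all_algebra.
From mathcomp Require Import reals.
From mathcomp Require Import mpoly zify ring.

Set Implicit Arguments.
Unset Strict Implicit.
Unset Printing Implicit Defensive.

Import Order.TTheory GRing.Theory Num.Theory.

Local Open Scope ring_scope.

(* As |E| = 2|I|, the claim says that the nullity |E| - rank equals the number of
   circuits, which holds as soon as the circuits are pairwise disjoint: removing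
   one edge from each of them then leaves a basis.

   The pin conditions give |F| <= 2|V(F)| - 2 for every nonempty F in the
   identified graph.  A circuit C attains this bound, and a nonempty independent
   set satisfies |F| <= 2|V(F)| - 3.  If distinct circuits C and C' met, C n C'
   would be independent, and adding up cardinalities of edge and vertex sets
   would make C u C' violate the bound.

   That a circuit attains the bound is the hard half of Laman's theorem, shown by
   induction with Henneberg moves: a Laman-sparse graph has a vertex v of degree
   at most 3.  If the degree is at most 2, delete v.  If v has neighbours a, b, c,
   some two of them, say a and b, can be joined by a new edge after deleting v
   without losing sparsity; placing v at the midpoint of ab reduces independence
   to that of the smaller graph, and independence at one placement implies
   independence at generic ones. *)

(** * Linear independence of families of vectors *)

(** Weights on the edge type itself spare the later arguments an enumeration of [F]. The columns are
    arbitrary, so that some of them may be deleted from the rigidity matrix. *)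
Lemma row_free_familyP (K : fieldType) (E : finType) (n : nat)
    (f : E -> 'I_n -> K) (F : {set E}) :
  reflect (forall w : E -> K, (forall k, \sum_(e in F) w e * f e k = 0) ->
             forall e, e \in F -> w e = 0)
          (row_free (\matrix_(i < #|F|, k < n) f (enum_val i) k)).
Proof.
set M := \matrix_(i, k) _.
have mulE (u : 'rV_#|F|) k :
    (u *m M) 0 k = \sum_(i < #|F|) u 0 i * f (enum_val i) k.
  by rewrite !mxE; apply: eq_bigr => i _; rewrite !mxE.
apply: (iffP idP) => [freeM w w0 e eF|w0].
  pose u : 'rV_#|F| := \row_i w (enum_val i).
  have u0 : u *m M = 0.
    apply/rowP => k; rewrite mulE [RHS]mxE -[RHS](w0 k) [RHS]big_enum_val.
    by apply: eq_bigr => i _; rewrite mxE.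
  have /rowP/(_ (enum_rank_in eF e)) : u = 0.
    by apply/(row_free_inj freeM); rewrite u0 mul0mx.
  by rewrite !mxE enum_rankK_in.
apply: inj_row_free => u /rowP uM; apply/rowP => i.
pose w e := u 0 (enum_rank_in (enum_valP i) e).
have -> : u 0 i = w (enum_val i) by rewrite /w enum_valK_in.
rewrite mxE; apply: w0 (enum_valP i) => k.
transitivity ((u *m M) 0 k); last by rewrite uM mxE.
by rewrite mulE [LHS]big_enum_val; apply: eq_bigr => j _; rewrite /w enum_valK_in.
Qed.

(** * Generic placements and polynomial conditions *)

Section Generic.
Variables (R : realType) (V : finType).
Implicit Types p : V -> 'rV[R]_2.
Let N := #|{: V * 'I_2}|.

Let coords p (k : 'I_N) : R := p (enum_val k).1 0 (enum_val k).2.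

Definition at_config p (q : {mpoly rat[N]}) : R :=
  meval (coords p) (map_mpoly (ratr : rat -> R) q).

HB.instance Definition _ p := GRing.RMorphism.copy (at_config p)
  (meval (coords p) \o map_mpoly (ratr : rat -> R)).

Definition coordX (v : V) (c : 'I_2) : {mpoly rat[N]} := 'X_(enum_rank (v, c)).

Lemma at_coordX p v c : at_config p (coordX v c) = p v 0 c.
Proof. by rewrite /at_config /coordX map_mpolyX mevalXU /coords enum_rankK. Qed.

(** A polynomial with a nonzero value at some placement is not the zero polynomial. *)
Lemma generic_neq0 p p0 (q : {mpoly rat[N]}) :
  generic p -> at_config p0 q != 0 -> at_config p q != 0.
Proof.
move=> gp q0; apply: gp; apply: contraNneq q0 => ->.
by rewrite rmorph0.
Qed.

(** Full row rank at [p0] is witnessed by a maximal minor, on the columns chosen by [g]. This minor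
    is a polynomial in the coordinates, nonzero at [p0] and hence at [p]. *)
Lemma generic_row_free m n (M : 'M[{mpoly rat[N]}]_(m, n)) p p0 :
  generic p -> row_free (map_mx (at_config p0) M) ->
  row_free (map_mx (at_config p) M).
Proof.
move=> gp; rewrite /row_free -mxrank_tr => fM.
pose g := fullrankfun fM.
have : rowsub g (map_mx (at_config p0) M)^T \in unitmx.
  exact: fullrowsub_unit.
have mapE p1 : rowsub g (map_mx (at_config p1) M)^T =
    map_mx (at_config p1) (rowsub g M^T).
  by apply/matrixP => i j; rewrite !mxE.
rewrite mapE unitmxE det_map_mx unitfE => /(generic_neq0 gp).
rewrite -det_map_mx -unitfE -unitmxE -mapE.
rewrite -row_full_unit /row_full => rkg.
rewrite -mxrank_tr eqn_leq rank_leq_col /=.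
by rewrite -{1}(eqP rkg) mxrankS // rowsub_sub.
Qed.
End Generic.

(** * Independence of edges in terms of stresses *)

Section Stress.
Variables (R : realType) (V E : finType).
Implicit Types (p : V -> 'rV[R]_2) (ends : E -> V * V) (F : {set E}).

(* Graphs are bare end maps here, so that a Henneberg move can redirect an edge in
   place without changing the edge type. *)
Definition edge_force p ends (e : E) (v : V) : 'rV[R]_2 :=
  if v == (ends e).1 then p (ends e).1 - p (ends e).2
  else if v == (ends e).2 then p (ends e).2 - p (ends e).1
  else 0.

(** Self-stresses, the left kernel of the rows of the rigidity matrix indexed by [F]. *)
Definition stress p ends F (w : E -> R) : Prop :=
  forall v, \sum_(e in F) w e *: edge_force p ends e v = 0.

Definition stress_free p ends F : Prop :=
  forall w, stress p ends F w -> forall e, e \in F -> w e = 0.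

Definition force_matrix p ends F : 'M[R]_(#|F|, #|{: V * 'I_2}|) :=
  \matrix_(i, k) edge_force p ends (enum_val i) (enum_val k).1 0 (enum_val k).2.

Lemma stress_freeP p ends F :
  reflect (stress_free p ends F) (row_free (force_matrix p ends F)).
Proof.
apply: (iffP (row_free_familyP
  (fun e k => edge_force p ends e (enum_val k).1 0 (enum_val k).2) F)).
- move=> free w w0; apply: free => k.
  move/rowP: (w0 (enum_val k).1) => /(_ (enum_val k).2).
  rewrite summxE [RHS]mxE; apply: etrans.
  by apply: eq_bigr => e _; rewrite [RHS]mxE.
- move=> free w w0; apply: free => v; apply/rowP => c.
  rewrite summxE [RHS]mxE; apply: etrans (w0 (enum_rank (v, c))).
  by apply: eq_bigr => e _; rewrite mxE enum_rankK.
Qed.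

Lemma independentP p (H : multigraph V E) F :
  reflect (stress_free p (ends H) F) (independent p H F).
Proof.
rewrite /independent.
suff -> : rigidity_matrix p H F = force_matrix p (ends H) F.
  exact: stress_freeP.
apply/matrixP => i k; rewrite !mxE /rigidity_entry /edge_force.
by do 2 case: ifP => _ //; rewrite mxE.
Qed.

Lemma stress_free_generic p p0 ends F :
  generic p -> stress_free p0 ends F -> stress_free p ends F.
Proof.
move=> gp /stress_freeP free0; apply/stress_freeP.
pose X (e : E) (k : 'I_#|{: V * 'I_2}|) :=
  let: (v, c) := enum_val k in
  let x := coordX (ends e).1 c - coordX (ends e).2 c in
  if v == (ends e).1 then x else if v == (ends e).2 then - x else 0.
have mapX p1 : force_matrix p1 ends F =
    map_mx (at_config p1) (\matrix_(i < #|F|, k < #|{: V * 'I_2}|) X (enum_val i) k).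
  apply/matrixP => i k; rewrite !mxE /X; case: (enum_val k) => v c /=.
  rewrite /edge_force; case: ifP => _; last case: ifP => _.
  - by rewrite rmorphB /= !at_coordX !mxE.
  - by rewrite rmorphN rmorphB /= !at_coordX !mxE opprB.
  - by rewrite rmorph0 mxE.
by move: free0; rewrite !mapX; apply: generic_row_free.
Qed.

Lemma stress_freeW p ends F F' :
  F' \subset F -> stress_free p ends F -> stress_free p ends F'.
Proof.
move=> sFF free w w0 e eF'.
(* A stress on [F'] extended by zero is a stress on [F]. *)
have := free (fun e => if e \in F' then w e else 0) _ e (subsetP sFF e eF').
rewrite eF'; apply=> v; apply: etrans (w0 v).
rewrite (big_setID F') /= (setIidPr sFF) [X in _ + X]big1 ?addr0.
  by apply: eq_bigr => e' ->.
by move=> e' /setDP[_ /negbTE ->]; rewrite scale0r.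
Qed.

(* [a], [b], [c] at (0,0), (1,0), (0,1): a placement at which the polynomials of
   the next two lemmas do not vanish. *)
Let corner (a b c : V) v : 'rV[R]_2 :=
  \row_k ((k == 0) && (v == b) || (k == 1) && (v == c))%:R.

Lemma generic_coord_neq p (u v : V) : generic p -> u != v -> p u 0 0 != p v 0 0.
Proof.
move=> gp uv; rewrite -subr_eq0.
have := @generic_neq0 R V p (corner v u v) (coordX u 0 - coordX v 0) gp.
rewrite !rmorphB /= !at_coordX; apply.
by rewrite !mxE !eqxx /= (eq_sym v) (negbTE uv) subr0 oner_eq0.
Qed.

Definition cross (x y : 'rV[R]_2) : R := x 0 0 * y 0 1 - x 0 1 * y 0 0.

Lemma generic_cross p (a b c : V) : generic p -> a != b -> a != c -> b != c ->
  cross (p b - p a) (p c - p a) != 0.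
Proof.
move=> gp ab ac bc.
have := @generic_neq0 R V p (corner a b c)
  ((coordX b 0 - coordX a 0) * (coordX c 1 - coordX a 1)
   - (coordX b 1 - coordX a 1) * (coordX c 0 - coordX a 0)) gp.
rewrite !(rmorphB, rmorphM) /= !at_coordX /cross !mxE; apply.
rewrite !eqxx /= (negbTE ab) (negbTE ac) (negbTE bc) /=.
by rewrite (eq_sym c) (negbTE bc) !subr0 mul1r mul0r subr0 oner_eq0.
Qed.

Lemma cross_free (x y : 'rV[R]_2) (s t : R) :
  cross x y != 0 -> s *: x + t *: y = 0 -> s = 0 /\ t = 0.
Proof.
rewrite /cross => xy0 /rowP st.
have := st 0; have := st 1; rewrite !mxE => e1 e0.
split; apply: (mulIf xy0); rewrite mul0r.
(* Cramer's rule: this combination of the two coordinates eliminates [t], and the next one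
   eliminates [s]. *)
- transitivity ((s * x 0 0 + t * y 0 0) * y 0 1 - (s * x 0 1 + t * y 0 1) * y 0 0).
    by ring.
  by rewrite e0 e1 !mul0r subr0.
- transitivity ((s * x 0 1 + t * y 0 1) * x 0 0 - (s * x 0 0 + t * y 0 0) * x 0 1).
    by ring.
  by rewrite e0 e1 !mul0r subr0.
Qed.
End Stress.

(** * Combinatorics of Laman-sparse graphs *)

Section Sparse.
Variables (V E : finType).
Implicit Types (ends : E -> V * V) (F : {set E}) (X Y Z : {set V}).

Definition induced ends F X : {set E} :=
  [set e in F | ((ends e).1 \in X) && ((ends e).2 \in X)].

(* Laman's condition; the singletons [X] exclude loops. *)
Definition sparse ends F : Prop :=
  forall X, induced ends F X != set0 -> (#|induced ends F X| + 3 <= 2 * #|X|)%N.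

(** In a sparse graph, a tight set inducing an edge attains Laman's bound. Sets of at most one
    vertex are tight too. *)
Definition tight ends F X : bool := (2 * #|X| <= #|induced ends F X| + 3)%N.

Definition touches ends (v : V) (e : E) := (v == (ends e).1) || (v == (ends e).2).

Definition star ends F v : {set E} := [set e in F | touches ends v e].

(** Meaningful only if [e] touches [v]; otherwise the value is the first end. *)
Definition opposite ends (v : V) (e : E) : V :=
  if v == (ends e).1 then (ends e).2 else (ends e).1.

Lemma in_induced ends F X e : (e \in induced ends F X) =
  [&& e \in F, (ends e).1 \in X & (ends e).2 \in X].
Proof. exact: in_set. Qed.

Lemma inducedS ends F F' X X' : F' \subset F -> X' \subset X ->
  induced ends F' X' \subset induced ends F X.
Proof.
move=> /subsetP sF /subsetP sX; apply/subsetP => e.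
by rewrite !inE => /and3P[/sF -> /sX -> /sX ->].
Qed.

Lemma sparseW ends F F' : F' \subset F -> sparse ends F -> sparse ends F'.
Proof.
move=> sF sp X X0; have sub := inducedS ends sF (subxx X).
apply: leq_trans (sp X _); first by rewrite leq_add2r subset_leq_card.
by apply: contraNneq X0 => X0; rewrite -subset0 -X0.
Qed.

Lemma sparse_small ends F X : sparse ends F -> (#|X| <= 1)%N ->
  induced ends F X = set0.
Proof.
move=> sp X1; apply/eqP; apply/negPn/negP => X0.
have := sp X X0; move: X0; rewrite -card_gt0; lia.
Qed.

Lemma sparse_loopless ends F e : sparse ends F -> e \in F ->
  (ends e).1 != (ends e).2.
Proof.
move=> sp eF; apply/eqP => loop.
have := sparse_small (X := [set (ends e).1]) sp.
by rewrite cards1 => /(_ isT) /setP /(_ e); rewrite !inE -loop eqxx eF.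
Qed.

Lemma opposite_neq ends F v e : sparse ends F -> e \in star ends F v ->
  opposite ends v e != v.
Proof.
move=> sp; rewrite inE /touches /opposite => /andP[eF].
have := sparse_loopless sp eF.
by case: (eqVneq v (ends e).1) => [->|] /=; rewrite eq_sym // => _ vn1 /eqP.
Qed.

(** Two parallel edges would violate the bound of one edge on two vertices. *)
Lemma opposite_inj ends F v e e' : sparse ends F ->
  e \in star ends F v -> e' \in star ends F v -> e != e' ->
  opposite ends v e != opposite ends v e'.
Proof.
move=> sp es es' ee'; apply/eqP => oo.
have in2 e0 : e0 \in star ends F v ->
    e0 \in induced ends F [set v; opposite ends v e0].
  rewrite !inE /touches /opposite => /andP[->].
  by case: eqVneq => [->|_ /= /eqP ->]; rewrite !eqxx ?orbT.
have sub : [set e; e'] \subset induced ends F [set v; opposite ends v e].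
  by rewrite subUset !sub1set in2 // oo in2.
have := subset_leq_card sub; rewrite cards2 ee' => le2.
have := sp [set v; opposite ends v e]; rewrite -card_gt0.
by rewrite cards2 eq_sym (opposite_neq sp es); lia.
Qed.

(** Double counting of incidences: if all degrees on the vertex set [X] of [F] were at least 4, then
    4|X| <= 2|F| <= 4|X| - 6. *)
Lemma low_degree ends F : sparse ends F -> F != set0 ->
  exists v, (0 < #|star ends F v| <= 3)%N.
Proof.
move=> sp F0; pose X := [set v | star ends F v != set0].
have indX : induced ends F X = F.
  apply/setP => e; rewrite !inE; case eF: (e \in F) => //=.
  by apply/andP; split; apply/set0Pn; exists e;
    rewrite inE eF /touches eqxx ?orbT.
have count2 : (\sum_(v in X) #|star ends F v| <= 2 * #|F|)%N.
  under eq_bigr => v _ do rewrite -sum1_card.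
  under eq_bigr => v _ do (under eq_bigl => e do rewrite inE; rewrite big_mkcondr).
  rewrite exchange_big mulnC -sum_nat_const leq_sum // => e _.
  rewrite -big_mkcondr sum1_card.
  apply: leq_trans (_ : #|[set (ends e).1; (ends e).2]| <= _)%N.
    by apply: subset_leq_card; apply/subsetP => v; rewrite !inE => /andP[].
  by rewrite cards2; case: (_ == _).
have [/existsP[v /andP[v0 v3]]|/existsPn none] :=
    boolP [exists v, (0 < #|star ends F v|)%N && (#|star ends F v| <= 3)%N].
  by exists v; rewrite v0.
have : (4 * #|X| <= \sum_(v in X) #|star ends F v|)%N.
  rewrite mulnC -sum_nat_const leq_sum // => v.
  rewrite inE -card_gt0 => v0; have := none v; rewrite v0 /=; lia.
have := sp X; rewrite indX => /(_ F0); lia.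
Qed.

Lemma induced_supermodular ends F X Y :
  (#|induced ends F X| + #|induced ends F Y| <=
   #|induced ends F (X :|: Y)| + #|induced ends F (X :&: Y)|)%N.
Proof.
rewrite -cardsUI leq_add // subset_leq_card //.
  by rewrite subUset !inducedS // ?subsetUl ?subsetUr.
by apply/subsetP => e; rewrite !inE => /andP[/and3P[-> -> ->] /and3P[_ -> ->]].
Qed.

(** Supermodularity passes the bound on the intersection to the union. With at least two vertices,
    the intersection obeys the bound even when it induces no edge. *)
Lemma tightU ends F X Y : sparse ends F -> (2 <= #|X :&: Y|)%N ->
  tight ends F X -> tight ends F Y -> tight ends F (X :|: Y).
Proof.
rewrite /tight => sp XY2 tX tY.
have := induced_supermodular ends F X Y; have := cardsUI X Y.
have : (#|induced ends F (X :&: Y)| + 3 <= 2 * #|X :&: Y|)%N.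
  by have [->|/sp //] := eqVneq (induced ends F (X :&: Y)) set0; rewrite cards0; lia.
lia.
Qed.

(** If two of the sets share two vertices, their union is tight by [tightU] and already contains all
    three points. Otherwise the edge counts add up to at least 2(|X| + |Y| + |Z|) - 9, while the
    union has at most |X| + |Y| + |Z| - 3 vertices, so it is tight. *)
Lemma tight_triangle ends F X Y Z a b c : sparse ends F ->
    a != c -> a \in X -> b \in X -> b \in Y -> c \in Y -> c \in Z -> a \in Z ->
    tight ends F X -> tight ends F Y -> tight ends F Z ->
  exists T : {set V}, [/\ T \subset X :|: Y :|: Z,
    a \in T, b \in T, c \in T & tight ends F T].
Proof.
move=> sp ac aX bX bY cY cZ aZ tX tY tZ.
have [XY|XY] := leqP 2 #|X :&: Y|.
  exists (X :|: Y); rewrite !inE aX bX cY orbT.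
  by split=> //; [exact: subsetUl|exact: tightU].
have [YZ|YZ] := leqP 2 #|Y :&: Z|.
  exists (Y :|: Z); rewrite !inE aZ bY cY orbT.
  by split=> //; [rewrite -setUA subsetUr|exact: tightU].
have [ZX|ZX] := leqP 2 #|Z :&: X|.
  exists (Z :|: X); rewrite !inE aX bX cZ !orbT.
  by split=> //; [rewrite subUset subsetUr -setUA subsetUl|exact: tightU].
exists (X :|: Y :|: Z); rewrite !inE aX bX cY !orbT; split=> //.
(* The three sets pairwise meet in at most one vertex, so no edge lies in two
   of them. *)
have indI A B : (#|A :&: B| < 2)%N -> induced ends F A :&: induced ends F B = set0.
  move=> AB; rewrite -(sparse_small (X := A :&: B) sp) //.
  apply/setP => e; rewrite !inE; case: (e \in F) => //=.
  by rewrite andbACA.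
have sub : induced ends F X :|: induced ends F Y :|: induced ends F Z
    \subset induced ends F (X :|: Y :|: Z).
  rewrite !subUset !inducedS ?subsetUr //.
    by rewrite -setUA setUCA subsetUl.
  by rewrite -setUA subsetUl.
have := subset_leq_card sub.
have := cardsUI (induced ends F X :|: induced ends F Y) (induced ends F Z).
have := cardsUI (induced ends F X) (induced ends F Y).
rewrite setIUl !indI ?(setIC X Z) // setU0 cards0.
have := cardsUI (X :|: Y) Z; have := cardsUI X Y.
have : (2 <= #|(X :|: Y) :&: Z|)%N.
  have <- : #|[set a; c]| = 2%N by rewrite cards2 ac.
  by apply: subset_leq_card; rewrite subUset !sub1set !inE aX aZ cY cZ !orbT.
have : (1 <= #|X :&: Y|)%N.
  by apply/card_gt0P; exists b; rewrite inE bX.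
move: tX tY tZ; rewrite /tight; lia.
Qed.

Definition replace_ends ends (e1 : E) (a b : V) (e : E) : V * V :=
  if e == e1 then (a, b) else ends e.

(** Such an [X] has no room for a new edge [ab]. Since singletons are tight, a pair with [a = b]
    different from [v] is always blocked. *)
Definition blocked ends F v a b : bool :=
  [exists X : {set V}, [&& v \notin X, a \in X, b \in X & tight ends F X]].

(** Among the sets avoiding [v], those containing [a] and [b] have room for the redirected [e1], as
    none of them is tight; the others induce no more edges than before. *)
Lemma sparse_replace ends F v e1 a b : sparse ends F ->
    e1 \in star ends F v -> a != v -> b != v ->
    ~~ blocked ends (F :\: star ends F v) v a b ->
  sparse (replace_ends ends e1 a b) (e1 |: F :\: star ends F v).
Proof.
set F0 := F :\: _ => sp e1s av bv unb.
set ends' := replace_ends _ _ _ _; set F' := _ |: _.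
have e1F0 : e1 \notin F0 by rewrite inE e1s.
have endsE e : e \in F0 -> ends' e = ends e.
  by rewrite /ends' /replace_ends; case: eqVneq => // ->; rewrite (negbTE e1F0).
have avoid X : v \notin X -> induced ends' F' X != set0 ->
    (#|induced ends' F' X| + 3 <= 2 * #|X|)%N.
  move=> vX indX.
  have [abX|abX] := boolP ((a \in X) && (b \in X)).
    have /andP[aX bX] := abX.
    have -> : induced ends' F' X = e1 |: induced ends F0 X.
      apply/setP => e; rewrite !inE; case: (eqVneq e e1) => [->|ne] /=.
        by rewrite /ends' /replace_ends eqxx.
      by rewrite /ends' /replace_ends (negbTE ne).
    rewrite cardsU1 inE (negbTE e1F0) /=.
    by have := existsPn unb X; rewrite vX aX bX /tight /=; lia.
  have sub : induced ends' F' X \subset induced ends F X.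
    apply/subsetP => e; rewrite inE => /andP[]; rewrite in_setU1.
    case: (eqVneq e e1) => [->|ne] /=.
      by rewrite /ends' /replace_ends eqxx /= (negbTE abX).
    by move=> eF0; rewrite endsE // inE => ->; move: eF0; rewrite inE => /andP[_ ->].
  apply: leq_trans (sp X _); first by rewrite leq_add2r subset_leq_card.
  by apply: contraNneq indX => X0; rewrite -subset0 -X0.
move=> X; have [vX|] := boolP (v \in X); last exact: avoid.
have -> : induced ends' F' X = induced ends' F' (X :\ v).
  apply/setP => e; rewrite !in_induced !in_setU1; case: (eqVneq e e1) => [->|_] /=.
    by rewrite /ends' /replace_ends eqxx !in_setD1 /= av bv.
  have [eF0|//] := boolP (e \in F0).
  rewrite endsE // !in_setD1; move: eF0; rewrite !inE /touches.
  rewrite !(eq_sym v).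
  by case: (e \in F); rewrite ?andbF //= andbT negb_or => /andP[-> ->].
move=> X0; apply: leq_trans (avoid _ _ X0) _; first by rewrite !inE eqxx.
by rewrite leq_mul2l subset_leq_card ?subsetDl.
Qed.


(** If all three pairs were blocked, [tight_triangle] would give a tight [T] avoiding [v] and
    containing its three neighbours. Adding [v] with its three edges yields at least 2|T| edges on
    |T| + 1 vertices, one more than sparsity allows. *)
Lemma unblocked_cubic ends F v e1 e2 e3 : sparse ends F ->
    star ends F v = [set e1; e2; e3] -> e1 != e2 -> e1 != e3 -> e2 != e3 ->
    let free e e' := ~~ blocked ends (F :\: star ends F v) v
                          (opposite ends v e) (opposite ends v e') in
  free e1 e2 \/ free e2 e3 \/ free e3 e1.
Proof.
move=> sp starE e12 e13 e23; set F0 := F :\: _.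
set a := opposite ends v e1; set b := opposite ends v e2.
set c := opposite ends v e3 => free; rewrite /free -/a -/b -/c {free}.
suff /or3P[] : [|| ~~ blocked ends F0 v a b, ~~ blocked ends F0 v b c
    | ~~ blocked ends F0 v c a] by auto.
rewrite -!negb_and; apply/negP.
case/and3P=> /existsP[X /and4P[vX aX bX tX]] /existsP[Y /and4P[vY bY cY tY]].
case/existsP=> Z /and4P[vZ cZ aZ tZ].
have [s1 s2 s3] : [/\ e1 \in star ends F v, e2 \in star ends F v
    & e3 \in star ends F v] by rewrite starE !inE !eqxx !orbT.
have ac : a != c by exact: opposite_inj sp s1 s3 e13.
have sF0 : F0 \subset F by exact: subsetDl.
have [T [/subsetP sT aT bT cT]] :=
  tight_triangle (sparseW sF0 sp) ac aX bX bY cY cZ aZ tX tY tZ.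
have vT : v \notin T.
  by apply: contra vX => /sT; rewrite !inE (negbTE vY) (negbTE vZ) !orbF.
have star_in e : e \in star ends F v -> opposite ends v e \in T ->
    e \in induced ends F (v |: T).
  rewrite !inE /touches /opposite => /andP[->].
  by case: eqVneq => [-> _|_ /= /eqP ->] -> /=; rewrite ?eqxx ?orbT.
have sub : star ends F v :|: induced ends F0 T \subset induced ends F (v |: T).
  rewrite subUset inducedS ?subsetUr // andbT.
  apply/subsetP => e es; apply: star_in => //; move: es.
  by rewrite starE !inE -orbA => /or3P[] /eqP ->.
have dis : star ends F v :&: induced ends F0 T = set0.
  by apply/setP => e; rewrite !inE; case: (e \in F); case: (touches _ _ _).
have := subset_leq_card sub; have := cardsUI (star ends F v) (induced ends F0 T).
have card3 : #|star ends F v| = 3%N.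
  by rewrite starE setUC cardsU1 cards2 !inE negb_or e12 (eq_sym e3) e13 (eq_sym e3) e23.
have := sp (v |: T); rewrite -card_gt0 cardsU1 vT dis cards0 card3 /tight /=.
move: #|_ :|: _| #|induced _ _ T| #|induced _ _ (_ |: _)| #|T| => m n k t; clear; lia.
Qed.
End Sparse.

(** * Sparse graphs are generically independent *)

Section Laman.
Variables (R : realType) (V E : finType).
Implicit Types (p : V -> 'rV[R]_2) (ends : E -> V * V) (F : {set E}).

Lemma edge_force_untouched p ends e v :
  ~~ touches ends v e -> edge_force p ends e v = 0.
Proof. by rewrite /touches /edge_force negb_or => /andP[/negbTE -> /negbTE ->]. Qed.

Lemma edge_force_touched p ends e v :
  touches ends v e -> edge_force p ends e v = p v - p (opposite ends v e).
Proof.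
by rewrite /touches /edge_force /opposite; case: eqVneq => [->|_ /= /eqP ->] //;
  rewrite eqxx.
Qed.

Lemma edge_force_opposite p ends e u v : touches ends v e -> u != v ->
  edge_force p ends e u =
    if u == opposite ends v e then p (opposite ends v e) - p v else 0.
Proof.
rewrite /touches /edge_force /opposite.
case: (eqVneq v (ends e).1) => [-> _ /negbTE -> //|_ /= /eqP -> /negbTE ->].
by [].
Qed.

Lemma stress_star p ends F w v : stress p ends F w ->
  \sum_(e in star ends F v) w e *: (p v - p (opposite ends v e)) = 0.
Proof.
move=> st; apply: etrans (st v); rewrite [RHS](big_setID (star ends F v)) /=.
rewrite [X in _ = _ + X]big1 ?addr0.
  apply: eq_big => e; first by rewrite !inE andbA andbb.
  by rewrite inE => /andP[_ tv]; rewrite edge_force_touched.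
move=> e; rewrite !inE negb_and => /andP[/orP[/negP//|nt] _].
by rewrite edge_force_untouched // scaler0.
Qed.

(** If equilibrium at [v] alone kills the weights on its star, what is left is a stress of the graph
    without [v]. *)
Lemma stress_free_add_vertex p ends F v :
    (forall w, \sum_(e in star ends F v) w e *: (p v - p (opposite ends v e)) = 0 ->
       forall e, e \in star ends F v -> w e = 0) ->
  stress_free p ends (F :\: star ends F v) -> stress_free p ends F.
Proof.
move=> free_v free w st e eF.
have w0 := free_v w (stress_star v st).
have [/w0//|es] := boolP (e \in star ends F v).
apply: free; last by rewrite inE es.
move=> u; apply: etrans (st u); rewrite [RHS](big_setID (star ends F v)) /=.
by rewrite [X in _ = X + _]big1 ?add0r // => e' /setIP[_ /w0 ->]; rewrite scale0r.
Qed.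

(** The Henneberg move at a vertex of degree 3: in the smaller graph [e1] joins [a] and [b]. A
    stress of [F] at the special placement [p0] is turned into a stress of that graph at [p], and
    [stress_free_generic] then leads from [p0] back to [p]. *)
Lemma stress_free_split_edge p ends F v e1 e2 e3 : generic p -> sparse ends F ->
    star ends F v = [set e1; e2; e3] -> e1 != e2 -> e1 != e3 -> e2 != e3 ->
    stress_free p
      (replace_ends ends e1 (opposite ends v e1) (opposite ends v e2))
      (e1 |: F :\: star ends F v) ->
  stress_free p ends F.
Proof.
move=> gp sp starE e12 e13 e23.
have [s1 s2 s3] : [/\ e1 \in star ends F v, e2 \in star ends F v
    & e3 \in star ends F v] by rewrite starE !inE !eqxx !orbT.
have av := opposite_neq sp s1; have bv := opposite_neq sp s2.
have cv := opposite_neq sp s3.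
have ab := opposite_inj sp s1 s2 e12; have ac := opposite_inj sp s1 s3 e13.
have bc := opposite_inj sp s2 s3 e23.
have [t1 t2 t3] : [/\ touches ends v e1, touches ends v e2 & touches ends v e3].
  by move: s1 s2 s3; rewrite !inE => /andP[_ ->] /andP[_ ->] /andP[_ ->].
set ends' := replace_ends _ _ _ _.
have ends'1 : ends' e1 = (opposite ends v e1, opposite ends v e2).
  by rewrite /ends' /replace_ends eqxx.
set a := opposite ends v e1 in av ab ac ends'1 *.
set b := opposite ends v e2 in bv ab bc ends'1 *.
set c := opposite ends v e3 in cv ac bc *.
set F0 := F :\: star ends F v => free.
have e1F0 : e1 \notin F0 by rewrite inE s1.
have sum_star (f : E -> 'rV[R]_2) :
    \sum_(e in star ends F v) f e = f e1 + f e2 + f e3.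
  rewrite starE setUC big_setU1 /=; last by rewrite !inE negb_or !(eq_sym e3) e13.
  by rewrite big_setU1 ?inE // big_set1 addrC.
(* Once [v] is the midpoint of [a] and [b], its equilibrium forces [e1] and [e2]
   to act as the single edge [ab]. *)
pose p0 u := if u == v then 2^-1 *: (p a + p b) else p u.
have p0v : p0 v = 2^-1 *: (p a + p b) by rewrite /p0 eqxx.
have p0E u : u != v -> p0 u = p u by rewrite /p0 => /negbTE ->.
apply: (stress_free_generic (p0 := p0) gp) => w st.
have := stress_star v st; rewrite sum_star -/a -/b -/c p0v !p0E // => eqv.
have [w12 w3] : w e1 - w e2 + w e3 = 0 /\ w e3 = 0.
  (* The equilibrium at [v], expanded in the basis [p b - p a], [p c - p a]. *)
  have [] := @cross_free R (p b - p a) (p c - p a)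
      (2^-1 * (w e1 - w e2 + w e3)) (- w e3) (generic_cross gp ab ac bc).
    by rewrite -eqv; apply/rowP => k; rewrite !mxE; field.
  move=> /eqP; rewrite mulf_eq0 invr_eq0 pnatr_eq0 /= => /eqP -> /eqP.
  by rewrite oppr_eq0 => /eqP ->.
move: w12; rewrite w3 addr0 => /eqP; rewrite subr_eq0 => /eqP w12.
have F0E e u : e \in F0 -> edge_force p0 ends e u = edge_force p ends e u.
  rewrite !inE negb_and => /andP[/orP[/negP//|]]; rewrite /touches negb_or.
  case/andP; rewrite !(eq_sym v) => n1 n2 _; by rewrite /edge_force !p0E.
(* The factor one half appears because [e1] reaches only from [a] to the midpoint, half of the
   vector from [a] to [b]. *)
have free_w : forall e, e \in e1 |: F0 ->
    (if e == e1 then 2^-1 * w e1 else w e) = 0.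
  apply: free => u; rewrite big_setU1 //= eqxx.
  have -> : \sum_(e in F0) (if e == e1 then 2^-1 * w e1 else w e) *:
      edge_force p ends' e u = \sum_(e in F0) w e *: edge_force p0 ends e u.
    apply: eq_bigr => e eF0; rewrite F0E //.
    have ne1 : e == e1 = false by apply: contraNF e1F0 => /eqP <-.
    by rewrite /edge_force /ends' /replace_ends ne1.
  have [->|uv] := eqVneq u v.
    rewrite big1 ?addr0 => [|e]; last first.
      rewrite !inE negb_and => /andP[/orP[/negP//|nt] _].
      by rewrite edge_force_untouched // scaler0.
    by rewrite edge_force_untouched ?scaler0 // /touches ends'1 /= !(eq_sym v)
      negb_or av bv.
  apply: etrans (st u); rewrite [RHS](big_setID (star ends F v)) /=; congr (_ + _).
  have -> : F :&: star ends F v = star ends F v.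
    by apply/setIidPr/subsetP => e; rewrite inE => /andP[].
  rewrite sum_star w3 scale0r addr0 !(edge_force_opposite p0 _ uv) // -/a -/b.
  rewrite p0v !p0E // -w12 /edge_force ends'1 /=.
  have [->|ua] := eqVneq u a.
    by rewrite (negbTE ab) scaler0 addr0; apply/rowP => k; rewrite !mxE; field.
  have [_|ub] := eqVneq u b; last by rewrite !scaler0 addr0.
  by rewrite scaler0 add0r; apply/rowP => k; rewrite !mxE; field.
have w1 : w e1 = 0.
  have := free_w e1; rewrite !inE eqxx => /(_ isT)/eqP.
  by rewrite mulf_eq0 invr_eq0 pnatr_eq0 => /eqP.
move=> e eF; have [es|es] := boolP (e \in star ends F v).
  by move: es; rewrite starE !inE -orbA => /or3P[] /eqP -> //; rewrite -w12.
have := free_w e; rewrite in_setU1 inE es eF orbT => /(_ isT).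
by case: eqVneq => [->|].
Qed.

(** The induction on the number of edges ranges over all end maps, as the move at degree 3 redirects
    an edge. *)
Lemma sparse_stress_free p ends F :
  generic p -> sparse ends F -> stress_free p ends F.
Proof.
move=> gp; have [n] := ubnP #|F|; elim: n ends F => // n IH ends F Fn sp.
have [->|F0] := eqVneq F set0; first by move=> w _ e; rewrite inE.
have [v /andP[d0 d3]] := low_degree sp F0.
have starF : star ends F v \subset F by apply/subsetP => e; rewrite inE => /andP[].
have cardD : #|F :\: star ends F v| = (#|F| - #|star ends F v|)%N.
  by rewrite cardsD (setIidPr starF).
have free0 : stress_free p ends (F :\: star ends F v).
  by apply: IH; [have := subset_leq_card starF; rewrite cardD;
    move: Fn d0; clear; lia|exact: sparseW (subsetDl _ _) sp].
(* At degree 1 or 2 the edge directions at [v] are linearly independent, since generic points are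
   distinct and not collinear. *)
have [d1|d1] := eqVneq #|star ends F v| 1%N.
  move/eqP/cards1P: d1 => [e1 starE]; apply: stress_free_add_vertex free0 => w.
  rewrite starE big_set1 => /rowP/(_ 0); rewrite !mxE => /eqP.
  have s1 : e1 \in star ends F v by rewrite starE inE.
  rewrite mulf_eq0 subr_eq0 (negbTE (generic_coord_neq gp _)) 1?eq_sym.
    by rewrite orbF => /eqP w0 e; rewrite inE => /eqP ->.
  exact: opposite_neq sp s1.
have [d2|d2] := eqVneq #|star ends F v| 2%N.
  move/eqP/cards2P: d2 => [e1 [e2 [e12 starE]]].
  apply: stress_free_add_vertex free0 => w.
  have s1 : e1 \in star ends F v by rewrite starE !inE eqxx.
  have s2 : e2 \in star ends F v by rewrite starE !inE eqxx orbT.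
  rewrite starE big_setU1 ?inE //= big_set1 => eqv.
  have [] := @cross_free R (p (opposite ends v e1) - p v)
      (p (opposite ends v e2) - p v) (w e1) (w e2).
  - by apply: generic_cross => //; rewrite 1?eq_sym;
      [exact: opposite_neq sp s1|exact: opposite_neq sp s2|];
      rewrite eq_sym (opposite_inj sp s1 s2).
  - by rewrite -oppr0 -eqv opprD -!scalerN !opprB.
  - by move=> w1 w2 e; rewrite !inE => /orP[] /eqP ->.
have {d0 d3 d1 d2} d3 : #|star ends F v| = 3%N by lia.
have [e1 s1] : exists e1, e1 \in star ends F v by apply/card_gt0P; rewrite d3.
have /eqP/cards2P[e2 [e3 [e23 starE1]]] : #|star ends F v :\ e1| = 2%N.
  by have := cardsD1 e1 (star ends F v); rewrite s1 d3 => -[].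
have /setD1P[e21 s2] : e2 \in star ends F v :\ e1 by rewrite starE1 !inE eqxx.
have /setD1P[e31 s3] : e3 \in star ends F v :\ e1.
  by rewrite starE1 !inE eqxx orbT.
have starE : star ends F v = [set e1; e2; e3] by rewrite -setUA -starE1 setD1K.
(* Stated for any labelling of the star, so that the three possible unblocked pairs differ by a
   rotation only. *)
have split x y z : star ends F v = [set x; y; z] ->
    x != y -> x != z -> y != z ->
    ~~ blocked ends (F :\: star ends F v) v
         (opposite ends v x) (opposite ends v y) ->
    stress_free p ends F.
  move=> starxyz xy xz yz unb.
  have sx : x \in star ends F v by rewrite starxyz !inE eqxx.
  have sy : y \in star ends F v by rewrite starxyz !inE eqxx orbT.
  apply: (stress_free_split_edge gp sp starxyz xy xz yz); apply: IH.
    have := subset_leq_card starF; rewrite cardsU1 cardD d3 inE sx /=.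
    by move: Fn; clear; lia.
  by apply: sparse_replace => //; exact: opposite_neq sp _.
have rot x y z : [set x; y; z] = [set y; z; x] :> {set E}.
  by rewrite -setUA setUC.
have [e12 e13] : e1 != e2 /\ e1 != e3 by rewrite !(eq_sym e1).
have [unb|[unb|unb]] := unblocked_cubic sp starE e12 e13 e23.
- exact: (split _ _ _ starE).
- exact: (split _ _ _ (etrans starE (rot _ _ _))).
- apply: (split _ _ _ (etrans starE (etrans (rot _ _ _) (rot _ _ _)))) unb => //.
  by rewrite eq_sym.
Qed.
End Laman.

(** * Independent edge sets satisfy Laman's bound *)

Section Count.
Variables (R : realType) (V E : finType).
Implicit Types (p m : V -> 'rV[R]_2) (ends : E -> V * V) (F : {set E}).

Definition dot (x y : 'rV[R]_2) : R := x 0 0 * y 0 0 + x 0 1 * y 0 1.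

Lemma dot_sum F (w : E -> R) (f : E -> 'rV[R]_2) x :
  dot x (\sum_(e in F) w e *: f e) = \sum_(e in F) w e * dot x (f e).
Proof.
rewrite /dot !summxE !mulr_sumr -big_split; apply: eq_bigr => e _ /=.
by rewrite !mxE; ring.
Qed.

(* The principle of virtual work: the resultant forces of any edge weighting do
   no work along an infinitesimal motion preserving all distances. *)
Lemma virtual_work p ends F w m :
    (forall e, e \in F -> (ends e).1 != (ends e).2) ->
    (forall x y, dot (m x - m y) (p x - p y) = 0) ->
  \sum_x dot (m x) (\sum_(e in F) w e *: edge_force p ends e x) = 0.
Proof.
move=> loopless rigid; under eq_bigr => x _ do rewrite dot_sum.
rewrite exchange_big big1 // => e /loopless ne /=; rewrite -mulr_sumr.
rewrite (bigD1 (ends e).1) // (bigD1 (ends e).2) 1?eq_sym //=.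
rewrite big1 ?addr0 => [|x /andP[n1 n2]]; last first.
  by rewrite /edge_force (negbTE n1) (negbTE n2) /dot !mxE !mulr0 addr0.
rewrite /edge_force !eqxx eq_sym (negbTE ne).
apply: etrans (_ : w e * dot (m (ends e).1 - m (ends e).2)
                     (p (ends e).1 - p (ends e).2) = 0).
  by rewrite /dot !mxE; ring.
by rewrite rigid mulr0.
Qed.

(** The plane's three infinitesimal isometries give three relations among the 2|X| columns. The rows
    therefore stay independent after deleting three suitable columns, and there are at most as many
    of them as remaining columns. *)
Lemma stress_free_count p ends F (X : {set V}) : generic p ->
    (forall e, e \in F -> (ends e).1 != (ends e).2) ->
    (forall e, e \in F -> (ends e).1 \in X /\ (ends e).2 \in X) ->
    F != set0 -> stress_free p ends F ->
  (#|F| + 3 <= 2 * #|X|)%N.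
Proof.
move=> gp loopless FX /set0Pn[e0 e0F] free.
set u := (ends e0).1; set v := (ends e0).2.
have uv : u != v := loopless e0 e0F.
have [uX vX] : u \in X /\ v \in X := FX e0 e0F.
(* The equilibrium equations at [u] and the second one at [v] are redundant. *)
pose D := [set (u, 0 : 'I_2); (u, 1); (v, 1)].
pose K := setX X [set: 'I_2] :\: D.
have cardK : #|K| = (2 * #|X| - 3)%N.
  rewrite cardsD cardsX cardsT card_ord mulnC; congr (_ - _)%N.
  have -> : setX X setT :&: D = D.
    apply/setIidPr/subsetP => k; rewrite !inE.
    by case/orP=> [/orP[]|] /eqP -> /=; rewrite ?uX ?vX.
  rewrite /D setUC cardsU1 cards2 !inE !xpair_eqE /=.
  by rewrite (eq_sym v) (negbTE uv) !eqxx.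
have X2 : (2 <= #|X|)%N.
  have <- : #|[set u; v]| = 2%N by rewrite cards2 uv.
  by rewrite subset_leq_card // subUset !sub1set uX vX.
suff : (#|F| <= #|K|)%N by rewrite cardK; move: X2; clear; lia.
pose f e (k : 'I_#|K|) := edge_force p ends e (enum_val k).1 0 (enum_val k).2.
suff /eqP <- : row_free (\matrix_(i < #|F|, k < #|K|) f (enum_val i) k).
  exact: rank_leq_col.
apply/row_free_familyP => w w0; apply: free.
pose r x := \sum_(e in F) w e *: edge_force p ends e x.
have rE x c : r x 0 c = \sum_(e in F) w e * edge_force p ends e x 0 c.
  by rewrite summxE; apply: eq_bigr => e _; rewrite mxE.
have r0 x c : (x, c) \notin D -> r x 0 c = 0.
  move=> nD; rewrite rE; have [xX|xX] := boolP (x \in X).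
    have kK : (x, c) \in K by rewrite in_setD nD !inE xX.
    have := w0 (enum_rank_in kK (x, c)); rewrite /f enum_rankK_in //.
  rewrite big1 // => e eF; have [aX bX] := FX e eF.
  rewrite /edge_force !ifN ?mxE ?mulr0 //.
  - by apply: contraNneq xX => ->.
  - by apply: contraNneq xX => ->.
have rx x : x != u -> x != v -> r x = 0.
  move=> xu xv; apply/rowP => c; rewrite mxE r0 // !inE !xpair_eqE.
  by rewrite (negbTE xu) (negbTE xv).
have work (m : V -> 'rV[R]_2) : (forall x y, dot (m x - m y) (p x - p y) = 0) ->
    dot (m u) (r u) + dot (m v) (r v) = 0.
  move=> rigid; apply: etrans (virtual_work w loopless rigid).
  rewrite (bigD1 u) // (bigD1 v) 1?eq_sym //=.
  rewrite [X in _ = _ + (_ + X)]big1 ?addr0 //.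
  move=> x /andP[xu xv]; have := rx x xu xv; rewrite /r => ->.
  by rewrite /dot !mxE !mulr0 addr0.
have rv0 : r v 0 0 = 0.
  by apply: r0; rewrite !inE !xpair_eqE (eq_sym v) (negbTE uv) ?eqxx /= ?eqxx.
(* Translations kill the first component of [r u] and make the second components of [r u] and [r v]
   opposite. The rotation [turn] then kills these, as [u] and [v] have distinct first
   coordinates. *)
pose shift (c : 'I_2) (x : V) : 'rV[R]_2 := delta_mx 0 c.
have shift_rigid c x y : dot (shift c x - shift c y) (p x - p y) = 0.
  by rewrite subrr /dot !mxE !mul0r addr0.
pose turn x : 'rV[R]_2 := \row_k (if k == 0 then - p x 0 1 else p x 0 0).
have turn_rigid x y : dot (turn x - turn y) (p x - p y) = 0.
  by rewrite /dot !mxE /=; ring.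
have := work _ (shift_rigid 0); have := work _ (shift_rigid 1).
have := work _ turn_rigid.
rewrite /dot !mxE /= !rv0 !(mul0r, mul1r, mulr0, addr0, add0r) => eq3 eq2 eq1.
have ru1 : r u 0 1 = 0.
  have : (p u 0 0 - p v 0 0) * r u 0 1 = 0.
    have ru_rv : r u 0 1 = - r v 0 1 by apply/eqP; rewrite -subr_eq0 opprK eq2.
    rewrite eq1 mulr0 add0r ru_rv in eq3.
    by rewrite ru_rv -[RHS]eq3; ring.
  move/eqP; rewrite mulf_eq0 subr_eq0 (negbTE (generic_coord_neq gp uv)) /=.
  by move/eqP.
have rv1 : r v 0 1 = 0 by rewrite -eq2 ru1 add0r.
move=> x; rewrite -/(r x); have [->|xu] := eqVneq x u.
  by apply/rowP; case=> [[|[|//]] i]; rewrite mxE;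
    [rewrite -[RHS]eq1|rewrite -[RHS]ru1]; congr (r u 0 _); exact: val_inj.
have [->|xv] := eqVneq x v; last exact: rx.
by apply/rowP; case=> [[|[|//]] i]; rewrite mxE;
  [rewrite -[RHS]rv0|rewrite -[RHS]rv1]; congr (r v 0 _); exact: val_inj.
Qed.
End Count.

(** * Nullity and disjoint circuits *)

Section Nullity.
Variables (R : realType) (V E : finType).
Implicit Types (p : V -> 'rV[R]_2) (H : multigraph V E) (F B C : {set E}).

Lemma independentW p H F F' :
  F' \subset F -> independent p H F -> independent p H F'.
Proof.
by move=> sF /independentP free; apply/independentP; apply: stress_freeW free.
Qed.

Lemma independent_leq_rank p H F :
  independent p H F -> (#|F| <= rigidity_rank p H)%N.
Proof.
move/eqP <-; rewrite /rigidity_rank.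
suff -> : rigidity_matrix p H F =
    rowsub (fun i => enum_rank_in (in_setT (enum_val i)) (enum_val i))
      (rigidity_matrix p H setT).
  exact/mxrankS/rowsub_sub.
by apply/matrixP => i k; rewrite !mxE enum_rankK_in.
Qed.

Lemma independent_rank_witness p H :
  exists2 B, independent p H B & #|B| = rigidity_rank p H.
Proof.
set M := rigidity_matrix p H setT.
pose g i := enum_val (maxrankfun M i) : E.
have g_inj : injective g by move=> i j /enum_val_inj /maxrankfun_inj.
exists (g @: setT); last by rewrite card_imset // cardsT card_ord.
apply/(row_free_familyP
  (fun e k => rigidity_entry p H e (enum_val k).1 (enum_val k).2)) => w w0.
have : \row_i w (g i) = 0.
  apply: (row_free_inj (maxrowsub_free M)); rewrite mul0mx.
  apply/rowP => k; rewrite [RHS]mxE; apply: etrans (w0 k).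
  rewrite big_imset /=; last by move=> i j _ _ /g_inj.
  rewrite mxE; apply: eq_big => [i|i _]; first by rewrite inE.
  by rewrite !mxE.
by move=> /rowP wg e /imsetP[i _ ->]; have := wg i; rewrite !mxE.
Qed.

(** The set [T] takes from each circuit one edge outside the basis [B]; by disjointness these are
    distinct. The complement of [T] contains [B], so it has at least rank many edges, and it
    contains no circuit, so it has at most that many. *)
Lemma nullity_disjoint_circuits p H :
    {in rigidity_circuits p H &, forall C C', C != C' -> [disjoint C & C']} ->
  (#|E| = rigidity_rank p H + #|rigidity_circuits p H|)%N.
Proof.
move=> disj; have [B indB cardB] := independent_rank_witness p H.
pose h C := [pick e in C :\: B].
have hP C : C \in rigidity_circuits p H -> exists2 e, h C = Some e & e \in C :\: B.
  rewrite inE /h => /minsetp depC; case: pickP => [e eCB|none]; first by exists e.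
  case/negP: depC; apply: independentW indB; apply/subsetP => e eC.
  by have := none e; rewrite !inE eC andbT => /negbFE.
pose T := [set e | Some e \in h @: rigidity_circuits p H].
have cardT : #|T| = #|rigidity_circuits p H|.
  rewrite -(card_in_imset (f := h)).
    have Some_inj : injective (@Some E) by move=> x y [].
    rewrite -(card_imset T Some_inj); apply: eq_card => o.
    apply/imsetP/idP => [[e]|]; first by rewrite inE => eT ->.
    case/imsetP=> C Ccirc ->; have [e hC _] := hP C Ccirc.
    by exists e => //; rewrite inE -hC imset_f.
  move=> C C' Ccirc C'circ hCC'; apply/eqP/negPn/negP => neq.
  have [e hC /setDP[eC _]] := hP C Ccirc.
  have [e' hC' /setDP[eC' _]] := hP C' C'circ.
  move: hCC'; rewrite hC hC' => -[ee']; rewrite -ee' in eC'.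
  have := disj C C' Ccirc C'circ neq; rewrite -setI_eq0 => /eqP /setP /(_ e).
  by rewrite !inE eC eC'.
have BT : B \subset ~: T.
  apply/subsetP => e eB; rewrite !inE; apply/imsetP => -[C Ccirc].
  by have [e' -> /setDP[_ e'B]] := hP C Ccirc; case=> ee'; rewrite -ee' eB in e'B.
have indT : independent p H (~: T).
  apply/negPn/negP => dep.
  have [C minC /subsetP sCT] := @minset_exists _ (fun F => ~~ independent p H F) _ dep.
  have Ccirc : C \in rigidity_circuits p H by rewrite inE.
  have [e hC /setDP[eC _]] := hP C Ccirc.
  by have := sCT e eC; rewrite !inE -hC imset_f.
have := independent_leq_rank indT; have := subset_leq_card BT.
have := cardsC T; rewrite cardT cardB; lia.
Qed.
End Nullity.

(** * Sizes and disjointness of circuits *)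

Section Circuits.
Variables (R : realType) (V E : finType).
Implicit Types (p : V -> 'rV[R]_2) (H : multigraph V E) (F C : {set E}).

Lemma end_vertices H F e : e \in F ->
  (ends H e).1 \in vertices H F /\ (ends H e).2 \in vertices H F.
Proof.
by move=> eF; split; rewrite inE; apply/existsP; exists e;
  rewrite eF /incident eqxx ?orbT.
Qed.

Lemma vertices_induced H F (X : {set V}) : vertices H (induced (ends H) F X) \subset X.
Proof.
apply/subsetP => v; rewrite inE => /existsP[e /andP[]]; rewrite in_induced.
by case/and3P=> _ e1 e2 /orP[] /eqP ->.
Qed.

Lemma verticesS H F F' : F \subset F' -> vertices H F \subset vertices H F'.
Proof.
move=> /subsetP sF; apply/subsetP => v; rewrite !inE => /existsP[e /andP[/sF eF ve]].
by apply/existsP; exists e; rewrite eF.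
Qed.

Lemma verticesU H F F' : vertices H (F :|: F') = vertices H F :|: vertices H F'.
Proof.
apply/eqP; rewrite eqEsubset subUset !verticesS ?subsetUl ?subsetUr // !andbT.
apply/subsetP => v; rewrite !inE => /existsP[e /andP[]].
by rewrite inE => /orP[] eF ve; apply/orP; [left|right]; apply/existsP;
  exists e; rewrite eF.
Qed.

Lemma independent_count p H F : generic p -> F != set0 -> independent p H F ->
  (#|F| + 3 <= 2 * #|vertices H F|)%N.
Proof.
move=> gp F0 /independentP; apply: stress_free_count => //.
  by move=> e _; exact: ends_neq.
exact: end_vertices.
Qed.

Lemma proper_circuit_independent p H F C : C \in rigidity_circuits p H ->
  F \subset C -> F != C -> independent p H F.
Proof.
rewrite inE => minC sFC; apply: contraNT => depF.
by rewrite (minsetinf minC depF sFC).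
Qed.

(** A circuit with fewer edges would be sparse: its proper subsets are independent and so satisfy
    the bound, and the circuit itself would too. It would then be independent. *)
Lemma circuit_count p H C : generic p -> C \in rigidity_circuits p H ->
  (2 * #|vertices H C| <= #|C| + 2)%N.
Proof.
move=> gp circC; rewrite leqNgt; apply/negP => small.
have := circC; rewrite inE => /minsetp /negP; apply.
apply/independentP; apply: sparse_stress_free => // X X0.
have vX := subset_leq_card (vertices_induced H C X).
have [eqC|neqC] := eqVneq (induced (ends H) C X) C.
  by move: vX small; rewrite eqC; clear; lia.
have sC : induced (ends H) C X \subset C.
  by apply/subsetP => e; rewrite inE => /andP[].
have := independent_count gp X0 (proper_circuit_independent circC sC neqC).
by move: vX; clear; lia.
Qed.

(** If distinct circuits met, |C| + |C'| >= 2|V(C)| + 2|V(C')| - 4 and |C n C'| <= 2|V(C) n V(C')| -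
    3 would give the union at least 2|V(C u C')| - 1 edges, one more than [count] allows. *)
Lemma circuits_disjoint p H : generic p ->
    (forall F, F != set0 -> (#|F| + 2 <= 2 * #|vertices H F|)%N) ->
  {in rigidity_circuits p H &, forall C C', C != C' -> [disjoint C & C']}.
Proof.
move=> gp count C C' circC circC' neq; rewrite -setI_eq0.
apply/negPn/negP => CC0.
have ind : independent p H (C :&: C').
  apply: (proper_circuit_independent circC (subsetIl _ _)).
  apply: contraNneq neq => /setIidPl sCC'; apply/eqP.
  move: circC circC'; rewrite !inE => /minsetp depC minC'.
  exact: minsetinf minC' depC sCC'.
have U0 : C :|: C' != set0.
  by apply: contraNneq CC0 => /eqP; rewrite setU_eq0 => /andP[/eqP -> _]; rewrite set0I.
have sI : vertices H (C :&: C') \subset vertices H C :&: vertices H C'.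
  by rewrite subsetI !verticesS ?subsetIl ?subsetIr.
have := count _ U0; rewrite verticesU.
have := independent_count gp CC0 ind; have := subset_leq_card sI.
have := circuit_count gp circC; have := circuit_count gp circC'.
have := cardsUI C C'; have := cardsUI (vertices H C) (vertices H C').
clear; lia.
Qed.
End Circuits.

(** * From the pin conditions to the identified graph *)

(** If [F] meets a pin, [None] is an extra vertex besides the inner ones, which turns the bound
    2|I'| into 2|V(F)| - 2. Without pins the bound 2|I'| - 3 is already stronger. *)
Lemma identified_count (I P E : finType) (G : pinned_graph I P E) (F : {set E}) :
    pinned_framework_conditions G -> F != set0 ->
  (#|F| + 2 <= 2 * #|vertices (identify_pins G) F|)%N.
Proof.
move=> [_ /(_ F)] /[apply] -[pin2 pin1 pin0].
set W := vertices _ F.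
have inner i : i \in inner_vertices G F -> Some i \in W.
  rewrite !inE => /existsP[e /andP[eF]]; rewrite /incident => ie.
  apply/existsP; exists e; rewrite eF /incident /=.
  by case/orP: ie => /eqP <-; rewrite eqxx ?orbT.
have pinned x : x \in pinned_vertices G F -> None \in W.
  rewrite !inE => /existsP[e /andP[eF]]; rewrite /incident => xe.
  apply/existsP; exists e; rewrite eF /incident /=.
  by case/orP: xe => /eqP <-; rewrite eqxx ?orbT.
have Some_inj : injective (@Some I) by move=> i j [].
have sW : Some @: inner_vertices G F \subset W.
  by apply/subsetP => _ /imsetP[i /inner iW ->].
have [p0|/set0Pn[x xp]] := eqVneq (pinned_vertices G F) set0.
  have := pin0 p0; have := subset_leq_card sW; rewrite card_imset //.
  by move: #|_| #|_| #|_|; lia.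
have sW' : None |: Some @: inner_vertices G F \subset W.
  by rewrite subUset sub1set sW (pinned x).
have := subset_leq_card sW'; rewrite cardsU1 card_imset //.
have -> : None \notin [set Some i | i in inner_vertices G F].
  by apply/imsetP => -[].
have [pin_1|pin_n1] := eqVneq #|pinned_vertices G F| 1%N.
  by have := pin1 pin_1; move: #|_| #|_| #|_|; lia.
have pin_2 : (2 <= #|pinned_vertices G F|)%N.
  have : (0 < #|pinned_vertices G F|)%N by apply/card_gt0P; exists x.
  by move: pin_n1; clear; lia.
by have := pin2 pin_2; move: #|_| #|_| #|_|; lia.
Qed.

Theorem theorem5 (R : realType) (I P E : finType) (G : pinned_graph I P E)
    (p : option I -> 'rV[R]_2) :
  pinned_framework_conditions G ->
  generic p ->
  dof p (identify_pins G) =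
    (#|rigidity_circuits p (identify_pins G)|)%:Z - 1.
Proof.
move=> pfc gp.
have := nullity_disjoint_circuits
  (circuits_disjoint gp (fun F => identified_count pfc)).
(* With |V| = |I| + 1 and |E| = 2|I|, the DOF is |E| - 1 minus the rank, one less than the
   nullity. *)
have [-> _] := pfc; rewrite /dof card_option.
by move: #|_| (rigidity_rank _ _) #|_|; lia.
Qed.
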